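(* Let $G$ be a connected graph of size $m$ with maximum degree $\Delta$ and minimum degree $\delta$. Then $$BSO(G)\leq \sqrt{m\, ID(G)},$$ with equality if and only if $G$ is a regular graph (when $G$ is non-bipartite) or $G$ is a $(\Delta,\delta)$-semiregular bipartite graph (when $G$ is bipartite).
   Context: Graphs are finite, simple and undirected; the size of a graph is its number of edges. For a connected graph $G$ with edge set $E(G)$, $d_v$ denotes the degree of the vertex $v$ in $G$. The first Banhatti-Sombor index is $BSO(G)=\sum_{uv\in E(G)}\sqrt{\frac{1}{d_u^2}+\frac{1}{d_v^2}}$ and the inverse degree index is $ID(G)=\sum_{uv\in E(G)}\left(\frac{1}{d_u^2}+\frac{1}{d_v^2}\right)$. A graph $G$ is called $(\Delta,\delta)$-semiregular if $\{d_u,d_v\}=\{\Delta,\delta\}$ holds for all edges $uv\in E(G)$ (the case $\Delta=\delta$ is allowed). *)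

(* Defs.v *)
From HB Require Import structures.
From mathcomp Require Import all_boot all_order all_algebra.

Set Implicit Arguments.
Unset Strict Implicit.
Unset Printing Implicit Defensive.

Import GRing.Theory Num.Theory.
Local Open Scope ring_scope.

Record sgraph := SGraph {
  vertex :> finType;
  adj : rel vertex;
  adj_sym : symmetric adj;
  adj_irrefl : irreflexive adj
}.

Section Graph.
Variable G : sgraph.

(* Each undirected edge uv is the two-element set [set u; v], so that it is
   counted once. *)
Definition edges : {set {set G}} :=
  [set [set u; v] | u in [set: G], v in [set: G] & adj u v].

Definition gsize : nat := #|edges|.

Definition degree (v : G) : nat := #|[set w | adj v w]|.

Definition max_degree : nat := \max_(v : G) degree v.

(* Every degree is smaller than #|G|, so the default value #|G| is attained
   only by the graph without vertices. *)
Definition min_degree : nat := \big[minn/#|G|]_(v : G) degree v.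

(* The graph without vertices is not considered connected. *)
Definition connected_graph : Prop :=
  (0 < #|G|)%N /\ forall u v : G, connect (@adj G) u v.

Definition bipartite : Prop :=
  exists A : {set G}, forall u v : G, adj u v -> (u \in A) != (v \in A).

Definition regular : Prop := exists k : nat, forall v : G, degree v = k.

(* [=i] on the two lists is the equality of the sets {d_u, d_v} and {a, b}. *)
Definition semiregular (a b : nat) : Prop :=
  forall u v : G, adj u v -> [:: degree u; degree v] =i [:: a; b].

Variable R : rcfType.

(* For an edge e = {u, v} this is 1 / d_u ^ 2 + 1 / d_v ^ 2; see
   [edge_weightE]. *)
Definition edge_weight (e : {set G}) : R :=
  \sum_(v in e) 1 / (degree v)%:R ^+ 2.

Lemma edge_weightE (u v : G) : adj u v ->
  edge_weight [set u; v] = 1 / (degree u)%:R ^+ 2 + 1 / (degree v)%:R ^+ 2.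
Proof.
move=> uv; have neq_uv : u \notin [set v].
  by rewrite inE; apply: contraTneq uv => ->; rewrite adj_irrefl.
by rewrite /edge_weight big_setU1 //= big_set1.
Qed.

Definition BSO : R := \sum_(e in edges) Num.sqrt (edge_weight e).

Definition ID : R := \sum_(e in edges) edge_weight e.

End Graph.

(* Main.v *)
Require Import Defs.
From HB Require Import structures.
From mathcomp Require Import all_boot all_order all_algebra.
From mathcomp Require Import ring.

Set Implicit Arguments.
Unset Strict Implicit.
Unset Printing Implicit Defensive.

Import GRing.Theory Num.Theory.
Local Open Scope ring_scope.

(** Write [w e] for the weight [1 / d_u ^ 2 + 1 / d_v ^ 2] of an edge [e = uv].
    The inequality is Cauchy-Schwarz for the family [sqrt (w e)] against the
    constant family 1, and equality holds exactly when all edges have the same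
    weight ([BSO_le_sqrt], [BSO_eq_sqrtP]).

    Two edges [uv] and [vw] share the term [1 / d_v ^ 2], so equal weights force
    [d_u = d_w].  Walking along paths from a fixed edge [u0 v0] of a connected
    graph, the degree thus alternates between [d_u0] and [d_v0]; hence the
    weight is constant if and only if the graph is semiregular for some pair of
    degrees ([constant_weight_semiregular], [semiregular_constant_weight]).

    The two cases only differ in how this pair is described.  As soon
    as there is an edge, all degrees belong to the pair and both members occur, so
    it consists of the maximum and the minimum degree
    ([semiregular_extremal_degrees]).  If its members differ, the vertices of
    one of the two degrees form a side of a bipartition; in a non-bipartite graph
    they therefore coincide and the graph is regular
    ([nonbipartite_semiregular_regular]). *)

(** * Cauchy-Schwarz for sums, with its equality case *)

(** Lagrange's identity against the constant family 1: it measures the defect in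
    the Cauchy-Schwarz inequality, and so gives the equality case as well. *)
Lemma sum_sqr_pairwise_diff (R : comPzRingType) (I : finType) (A : {set I})
    (x : I -> R) :
  \sum_(i in A) \sum_(j in A) (x i - x j) ^+ 2 =
    2 * (#|A|%:R * \sum_(i in A) x i ^+ 2 - (\sum_(i in A) x i) ^+ 2).
Proof.
have inner i : \sum_(j in A) (x i - x j) ^+ 2 =
    #|A|%:R * x i ^+ 2 - 2 * (\sum_(j in A) x j) * x i
    + \sum_(j in A) x j ^+ 2.
  under eq_bigr => j _ do rewrite sqrrB.
  rewrite big_split sumrB /= sumr_const mulr_natl; congr (_ - _ + _).
  by rewrite sumrMnl -mulr_sumr; ring.
under eq_bigr => i _ do rewrite inner.
rewrite big_split sumrB /= -!mulr_sumr sumr_const -mulr_natl.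
ring.
Qed.

Lemma sqr_sum_leif (R : realDomainType) (I : finType) (A : {set I})
    (x : I -> R) :
  (\sum_(i in A) x i) ^+ 2 <= #|A|%:R * \sum_(i in A) x i ^+ 2
    ?= iff [forall i in A, forall j in A, x i == x j].
Proof.
have diff_ge0 i : 0 <= \sum_(j in A) (x i - x j) ^+ 2.
  by apply: sumr_ge0 => j _; apply: sqr_ge0.
have := sum_sqr_pairwise_diff A x; set D := _ - _ => defD; split.
  rewrite -subr_ge0 -/D -(@pmulr_rge0 _ 2) ?ltr0n // -defD.
  by apply: sumr_ge0.
rewrite eq_sym -subr_eq0 -/D -(@mulrI_eq0 _ 2); last first.
  by apply/lregP; rewrite pnatr_eq0.
rewrite -defD psumr_eq0 //; apply/allP/forall_inP => [eq0 i Ai|eqx i _].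
  apply/forall_inP => j Aj; move: (eq0 i); rewrite mem_index_enum Ai => /(_ isT).
  rewrite psumr_eq0 => [/allP/(_ j)|k _]; last exact: sqr_ge0.
  by rewrite mem_index_enum Aj sqrf_eq0 subr_eq0; apply.
apply/implyP => Ai; apply/eqP/big1 => j Aj; apply/eqP.
by rewrite sqrf_eq0 subr_eq0; move/forall_inP: (eqx i Ai); apply.
Qed.

(** * Edge weights and the equality case *)

Section EdgeWeights.
Variables (R : rcfType) (G : sgraph).
Implicit Types (u v w : G) (e f : {set G}).

Lemma mem_edges u v : adj u v -> [set u; v] \in edges G.
Proof. by move=> uv; apply/imset2P; exists u v; rewrite ?inE. Qed.

Lemma edgesP e : e \in edges G -> exists u v, adj u v /\ e = [set u; v].
Proof. by case/imset2P => u v _; rewrite inE => /andP[_ uv] ->; exists u, v. Qed.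

Definition constant_weight : Prop :=
  {in edges G &, forall e f, edge_weight R e = edge_weight R f}.

Lemma edge_weight_ge0 e : 0 <= edge_weight R e.
Proof. by apply: sumr_ge0 => v _; rewrite divr_ge0 ?sqr_ge0. Qed.

Lemma ID_ge0 : 0 <= ID G R.
Proof. by apply: sumr_ge0 => e _; apply: edge_weight_ge0. Qed.

Lemma BSO_ge0 : 0 <= BSO G R.
Proof. by apply: sumr_ge0 => e _; apply: sqrtr_ge0. Qed.

Lemma sqr_BSO_leif :
  BSO G R ^+ 2 <= (gsize G)%:R * ID G R
    ?= iff [forall e in edges G, forall f in edges G,
              Num.sqrt (edge_weight R e) == Num.sqrt (edge_weight R f)].
Proof.
have -> : ID G R = \sum_(e in edges G) Num.sqrt (edge_weight R e) ^+ 2.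
  by apply: eq_bigr => e _; rewrite sqr_sqrtr ?edge_weight_ge0.
exact: sqr_sum_leif.
Qed.

Lemma BSO_le_sqrt : BSO G R <= Num.sqrt ((gsize G)%:R * ID G R).
Proof.
rewrite -[leLHS]ger0_norm ?BSO_ge0 // -sqrtr_sqr.
by apply: ler_wsqrtr; apply: sqr_BSO_leif.
Qed.

(** Both sides are nonnegative, so the equation can be squared into the equality
    case of [sqr_BSO_leif]; the square roots of the weights then agree exactly
    when the weights do. *)
Lemma BSO_eq_sqrtP :
  BSO G R = Num.sqrt ((gsize G)%:R * ID G R) <-> constant_weight.
Proof.
have -> : BSO G R = Num.sqrt ((gsize G)%:R * ID G R) <->
    BSO G R ^+ 2 = (gsize G)%:R * ID G R.
  split=> [->|<-]; last by rewrite sqrtr_sqr ger0_norm ?BSO_ge0.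
  by rewrite sqr_sqrtr // mulr_ge0 ?ID_ge0.
split=> [/eqP|const_w].
  rewrite sqr_BSO_leif => /forall_inP eq_w e f Ee Ef.
  have /forall_inP/(_ f Ef) := eq_w e Ee.
  by rewrite eqr_sqrt ?edge_weight_ge0 // => /eqP.
apply/eqP; rewrite sqr_BSO_leif; apply/forall_inP => e Ee.
by apply/forall_inP => f Ef; rewrite (const_w e f).
Qed.

Lemma inv_sqr_natr_inj (a b : nat) :
  1 / a%:R ^+ 2 = 1 / b%:R ^+ 2 :> R -> a = b.
Proof.
rewrite !div1r => /invr_inj/eqP; rewrite eqrXn2 ?ler0n // eqr_nat.
exact: eqP.
Qed.

(** The two edges share the contribution of [v]; the other ends must contribute
    equally. *)
Lemma constant_weight_degree u v w :
  constant_weight -> adj u v -> adj v w -> degree u = degree w.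
Proof.
move=> const_w uv vw.
have := const_w _ _ (mem_edges uv) (mem_edges vw).
by rewrite !edge_weightE // addrC => /addrI/inv_sqr_natr_inj.
Qed.

Lemma connected_ind (P : G -> Prop) u :
    connected_graph G -> P u -> (forall v w, adj v w -> P v -> P w) ->
  forall v, P v.
Proof.
move=> [_ conn] Pu step v; have /connectP[p] := conn u v.
by elim: p u Pu => [|w p IHp] u Pu /= => [_ -> //|/andP[/step uw /IHp]]; auto.
Qed.

(** The property carried along paths is that all edges at a vertex have the
    degrees of [uv] at their ends.  It passes from [x] to a neighbour [y] because
    every other neighbour of [y] has the degree of [x]. *)
Lemma constant_weight_semiregular u v :
  connected_graph G -> constant_weight -> adj u v ->
  semiregular G (degree u) (degree v).
Proof.
move=> conn const_w uv.
apply: (connected_ind conn (u := u)) => [w uw|x y xy IHx z yz] k.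
  by rewrite (@constant_weight_degree v u w) // adj_sym.
rewrite -(constant_weight_degree const_w xy yz) -(IHx y xy k).
by rewrite !inE orbC.
Qed.

Lemma semiregular_edge_weight (a b : nat) u v :
  semiregular G a b -> adj u v ->
  edge_weight R [set u; v] = 1 / a%:R ^+ 2 + 1 / b%:R ^+ 2.
Proof.
move=> semi uv; rewrite edge_weightE //; have eq_ab := semi u v uv.
have := eq_ab (degree u); have := eq_ab (degree v).
have := eq_ab a; have := eq_ab b.
rewrite !inE !eqxx ?orbT /=.
case: (eqVneq (degree u) a) => [->|_].
  case: (eqVneq (degree v) b) => [-> //|_] /=.
  by case: eqVneq => //= -> _ _ /esym; rewrite orbF => /eqP->.
case: (eqVneq (degree u) b) => //= -> _ + _ _.
by case: (eqVneq (degree v) a) => [-> _|]; first exact: addrC.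
Qed.

Lemma semiregular_constant_weight (a b : nat) :
  semiregular G a b -> constant_weight.
Proof.
move=> semi _ _ /edgesP[u [v [uv ->]]] /edgesP[x [y [xy ->]]].
by rewrite !(semiregular_edge_weight semi).
Qed.

End EdgeWeights.

(** * Semiregular connected graphs *)

Section SemiregularGraphs.
Variable G : sgraph.
Hypothesis G_conn : connected_graph G.
Implicit Types u v w : G.

Lemma regular_semiregular (k : nat) :
  (forall v, degree v = k) -> semiregular G k k.
Proof. by move=> reg u v _ x; rewrite !reg. Qed.

Lemma semiregular_degrees (a b : nat) u v :
  semiregular G a b -> adj u v -> forall w, degree w \in [:: a; b].
Proof.
move=> semi uv; apply: (connected_ind G_conn (u := u)) => [|x y xy _].
  by rewrite -(semi u v uv) mem_head.
by rewrite -(semi x y xy) !inE eqxx orbT.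
Qed.

Lemma degree_le_max v : (degree v <= max_degree G)%N.
Proof. exact: leq_bigmax. Qed.

Lemma min_le_degree v : (min_degree G <= degree v)%N.
Proof. by rewrite /min_degree -minEnat -leEnat Order.TotalTheory.bigmin_le. Qed.

Lemma extremal_degrees u v :
    (forall w, degree v <= degree w <= degree u)%N ->
  max_degree G = degree u /\ min_degree G = degree v.
Proof.
move=> bounds; split; apply: anti_leq.
  rewrite degree_le_max andbT; apply/bigmax_leqP => w _.
  by case/andP: (bounds w).
rewrite min_le_degree; apply: (big_ind (leq (degree v))) => [|x y le_x le_y|w _].
(* The default value of the minimum must be bounded too. *)
- exact: max_card.
- by rewrite leq_min le_x.
- by case/andP: (bounds w).
Qed.

(** By connectedness no degree other than those of [u] and [v] occurs, so these
    two are the extremal ones. *)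
Lemma semiregular_extremal_degrees u v :
    semiregular G (degree u) (degree v) -> adj u v ->
  semiregular G (max_degree G) (min_degree G).
Proof.
wlog le_vu : u v / (degree v <= degree u)%N => [IH semi uv|semi uv].
  have [/IH|/ltnW/IH] := leqP (degree v) (degree u); first exact.
  apply; last by rewrite adj_sym.
  by move=> x y xy k; rewrite (semi x y xy) !inE orbC.
have [|-> -> //] := @extremal_degrees u v => w.
have := semiregular_degrees semi uv w.
by rewrite !inE => /orP[] /eqP->; rewrite leqnn ?andbT.
Qed.

(** When [a] and [b] differ, every edge joins a vertex of degree [a] to one of
    degree [b]. *)
Lemma nonbipartite_semiregular_regular (a b : nat) u v :
  ~ bipartite G -> semiregular G a b -> adj u v -> regular G.
Proof.
move=> nbip semi uv; have deg_ab := semiregular_degrees semi uv.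
have [eq_ab|neq_ab] := eqVneq a b.
  by exists b => w; have := deg_ab w; rewrite eq_ab !inE orbb => /eqP.
case: nbip; exists [set w | degree w == a] => x y xy; rewrite !inE.
have := semi x y xy a; have := semi x y xy b.
rewrite !inE !eqxx orbT /= !(eq_sym _ (degree _)).
case: (eqVneq (degree x) a) => [->|_] /=; last by move=> _ ->.
by rewrite (negPf neq_ab) => /eqP-> _; rewrite [b == a]eq_sym (negPf neq_ab).
Qed.

End SemiregularGraphs.

Theorem theorem3p9 (R : rcfType) (G : sgraph) (m Delta delta : nat)
    (G_conn : connected_graph G) (G_size : gsize G = m)
    (G_max : max_degree G = Delta) (G_min : min_degree G = delta) :
  BSO G R <= Num.sqrt (m%:R * ID G R) /\
  (~ bipartite G ->
     (BSO G R = Num.sqrt (m%:R * ID G R) <-> regular G)) /\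
  (bipartite G ->
     (BSO G R = Num.sqrt (m%:R * ID G R) <-> semiregular G Delta delta)).
Proof.
rewrite -G_size -G_max -G_min; split; first exact: BSO_le_sqrt.
split=> [nbip|_]; rewrite BSO_eq_sqrtP; split.
- move=> const_w.
  case: (pickP (fun uv : G * G => adj uv.1 uv.2)) => [[u v] /= uv|no_edge].
    have semi := constant_weight_semiregular G_conn const_w uv.
    exact: nonbipartite_semiregular_regular nbip semi uv.
  (* A graph without edges is bipartite. *)
  by case: nbip; exists set0 => u v uv; have := no_edge (u, v); rewrite /= uv.
- by case=> k /regular_semiregular; apply: semiregular_constant_weight.
- move=> const_w u v uv.
  have semi := constant_weight_semiregular G_conn const_w uv.
  exact: (semiregular_extremal_degrees G_conn semi uv).
- exact: semiregular_constant_weight.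
Qed.
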